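(* Let $G$ be a graph and let $t$ be a fixed positive integer. Then $\operatorname{th}_{\lfloor \operatorname{Z}_+\rfloor}(G) \leq t$ if and only if there exist positive integers $a, k$ and a non-negative integer $b$ such that $a + b = t$ and $G$ can be obtained from the Cartesian product $K_a \square T_{k,b}$ by contracting tree edges and/or deleting edges (of any kind).
   Context: All graphs are finite, simple and undirected (multiple edges created by a contraction are replaced by a single edge). The $\lfloor \operatorname{Z}_+\rfloor$ color change rule: vertices are blue or white. Let $B$ be the current set of blue vertices of $G$ and let $W_1,\dots,W_m$ be the vertex sets of the connected components of $G-B$. For each $i$ there is a set $A_i\subseteq B$ of vertices that are active with respect to $W_i$. If $u\in A_i$, $w\in W_i$, and every neighbor of $u$ in $G[W_i\cup B]-w$ is blue, then $u$ can force $w$ to become blue (written $u\to w$). (So either $w$ is the only white neighbor of $u$ in $G[B\cup W_i]$, or $u$ has no white neighbor there and forces $w$ by ''hopping''.) After $u\to w$, $u$ is removed from $A_i$ and $w$ becomes active with respect to $W_i$; the components into which $W_i\setminus\{w\}$ breaks inherit this updated active set. Initially, every vertex of the initial blue set is active with respect to every component. For $B\subseteq V(G)$ initially blue (all other vertices white), a chronological list of forces of $B$ is an ordered list of valid forces performed consecutively until no further force is possible; the set of forces in such a list is called a set of forces of $B$. For a set $\mathcal F$ of forces of $B$, let $\mathcal F^{(0)}=B$ and let $\mathcal F^{(s+1)}$ be the set of white vertices $w$ such that some $(u\to w)\in\mathcal F$ is a valid force when exactly $\bigcup_{i=0}^{s}\mathcal F^{(i)}$ is blue. Let $\operatorname{pt}_{\lfloor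 \operatorname{Z}_+\rfloor}(G;\mathcal F)$ be the least $s$ with $\bigcup_{i=0}^{s}\mathcal F^{(i)}=V(G)$ ($\infty$ if there is none), let $\operatorname{pt}_{\lfloor \operatorname{Z}_+\rfloor}(G;B)$ be the minimum of this over all sets $\mathcal F$ of forces of $B$, and let $\operatorname{th}_{\lfloor \operatorname{Z}_+\rfloor}(G)=\min_{B\subseteq V(G)}\big(|B|+\operatorname{pt}_{\lfloor \operatorname{Z}_+\rfloor}(G;B)\big)$. For integers $k>0$ and $b\ge 0$, $T_{k,b}$ is the rooted tree of height $b$ in which every vertex of depth less than $b$ has exactly $k$ children. In $K_a\square T_{k,b}$, the tree edges are the edges in the copies of $T_{k,b}$.
   Formalization: In each time step a vertex performs at most one force of F into each current white component (literally, several simultaneous hops would count and the claim fails); active sets come from performing the step's forces in some order; G is nonempty. *)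

(* Defs.v *)
From mathcomp Require Import all_boot.
From mathcomp Require Import boolp.

Set Implicit Arguments.
Unset Strict Implicit.
Unset Printing Implicit Defensive.

(* Finite simple graphs. *)

Record sgraph := SGraph {
  vertex :> finType;
  adj : rel vertex;
  adj_sym : symmetric adj;
  adj_irr : irreflexive adj }.

Definition isomorphic (G H : sgraph) : Prop :=
  exists2 f : G -> H, bijective f & forall x y, adj (f x) (f y) = adj x y.

(* Minima over nat with values in nat extended by infinity (None). *)

Definition einf (P : nat -> Prop) : option nat :=
  match pselect (exists n, `[< P n >]) with
  | left ex_n => Some (ex_minn ex_n)
  | right _ => None
  end.

Definition le_enat (x : option nat) (n : nat) : bool :=
  if x is Some m then m <= n else false.

Section Forcing.
Variable G : sgraph.
Implicit Types (B : {set G}) (u w x : G).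

(* The component of G - B that contains x, for x \notin B. *)
Definition white_comp B x : {set G} :=
  [set y | connect [rel p q | [&& adj p q, p \notin B & q \notin B]] x y].

(* For a white vertex x, [active c x] is the active set of the component of
   G - blue c that contains x; its value at blue vertices is irrelevant. *)
Record config := Config { blue : {set G}; active : G -> {set G} }.
Implicit Type c : config.

Definition init B : config := Config B (fun=> B).

Definition valid c u w : bool :=
  [&& w \notin blue c, u \in active c w &
      [forall v in (white_comp (blue c) w :|: blue c) :\ w,
        adj u v ==> (v \in blue c)]].

(* u -> w changes the active set of the component containing w only, and the
   components of what remains of it inherit the new active set. *)
Definition perform c (f : G * G) : config :=
  let: (u, w) := f in
  Config (w |: blue c)
    (fun x => if x \in white_comp (blue c) w then w |: (active c x :\ u)
              else active c x).

Fixpoint chronological c (L : seq (G * G)) : Prop :=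
  match L with
  | [::] => forall u w, ~~ valid c u w
  | f :: L' => valid c f.1 f.2 /\ chronological (perform c f) L'
  end.

Definition set_of_forces B (F : {set G * G}) : Prop :=
  exists2 L, chronological (init B) L & F = [set f in L].

(* One time step: all the forces of F that are valid at c are performed
   simultaneously (the new blue vertices are the next layer of F).  A force
   u -> w makes u inactive with respect to the component of w, so within one
   step u performs a single force into each component of G - blue c.  Two
   forces of F from u into one component, each valid on its own, can occur
   when both are hops; then only one of them is performed in this step.
   The new active sets come from performing the forces of the step one after
   the other, in any order. *)
Definition time_step (F : {set G * G}) c c' : Prop :=
  exists S : seq (G * G),
    [/\ uniq S,
        (forall u w, (u, w) \in S -> (u, w) \in F /\ valid c u w),
        (forall u w w', (u, w) \in S -> (u, w') \in S ->
           w' \in white_comp (blue c) w -> w' = w),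
        (forall u w, (u, w) \in F -> valid c u w ->
           exists2 w', (u, w') \in S & w' \in white_comp (blue c) w) &
        c' = foldl perform c S].

Fixpoint all_blue_after (F : {set G * G}) (s : nat) c : Prop :=
  match s with
  | 0 => blue c = [set: G]
  | s'.+1 => exists2 c', time_step F c c' & all_blue_after F s' c'
  end.

Definition pt_forces B (F : {set G * G}) : option nat :=
  einf (fun s => all_blue_after F s (init B)).

Definition pt B : option nat :=
  einf (fun s => exists2 F, set_of_forces B F & pt_forces B F = Some s).

Definition th : option nat :=
  einf (fun n => exists B s, pt B = Some s /\ n = #|B| + s).

End Forcing.

(* Graphs in which some of the edges are marked as tree edges. *)

Record tgraph := TGraph {
  tbase :> sgraph;
  tree_edge : rel tbase;
  tree_edge_sym : symmetric tree_edge;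
  tree_edge_adj : subrel tree_edge (@adj tbase) }.

Section Operations.
Variables (H : tgraph) (x y : H).

Definition del_rel (e : rel H) : rel H :=
  [rel u v | e u v && ([set u; v] != [set x; y])].

Lemma del_rel_sym e : symmetric e -> symmetric (del_rel e).
Proof. by move=> es u v; rewrite /del_rel /= (es u v) setUC. Qed.

Lemma del_rel_irr e : irreflexive e -> irreflexive (del_rel e).
Proof. by move=> ei u; rewrite /del_rel /= ei. Qed.

Lemma del_rel_sub e e' : subrel e e' -> subrel (del_rel e) (del_rel e').
Proof. by move=> ee' u v /andP[/ee' uv ne]; apply/andP. Qed.

Definition delete_edge : tgraph :=
  @TGraph (SGraph (del_rel_sym (@adj_sym H)) (del_rel_irr (@adj_irr H)))
    _ (del_rel_sym (@tree_edge_sym H)) (del_rel_sub (@tree_edge_adj H)).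

(* Contracting the edge xy: y is merged into x. *)
Definition merge (z : H) : H := if z == y then x else z.

Definition contr_rel (e : rel H) : rel {z : H | z != y} :=
  [rel u v | (u != v) && [exists p, exists q,
     [&& merge p == val u, merge q == val v & e p q]]].

Lemma contr_rel_sym e : symmetric e -> symmetric (contr_rel e).
Proof.
move=> es u v; rewrite /contr_rel /= eq_sym; congr (_ && _).
by apply/existsP/existsP => -[p /existsP[q /and3P[pu qv epq]]];
   exists q; apply/existsP; exists p; rewrite pu qv (es q p).
Qed.

Lemma contr_rel_irr e : irreflexive (contr_rel e).
Proof. by move=> u; rewrite /contr_rel /= eqxx. Qed.

Lemma contr_rel_sub e e' : subrel e e' -> subrel (contr_rel e) (contr_rel e').
Proof.
move=> ee' u v /andP[uv /existsP[p /existsP[q /and3P[pu qv /ee' epq]]]].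
by apply/andP; split=> //; apply/existsP; exists p; apply/existsP; exists q;
   apply/and3P.
Qed.

Definition contract_edge : tgraph :=
  @TGraph (SGraph (contr_rel_sym (@adj_sym H)) (@contr_rel_irr (@adj H)))
    _ (contr_rel_sym (@tree_edge_sym H)) (contr_rel_sub (@tree_edge_adj H)).

End Operations.

Inductive reduces (H : tgraph) : tgraph -> Prop :=
| Reduces_refl : reduces H H
| Reduces_delete (H' : tgraph) (x y : H') :
    reduces H H' -> adj x y -> reduces H (delete_edge x y)
| Reduces_contract (H' : tgraph) (x y : H') :
    reduces H H' -> tree_edge x y -> reduces H (contract_edge x y).

Definition obtainable (H : tgraph) (G : sgraph) : Prop :=
  exists2 H', reduces H H' & isomorphic H' G.

Section Complete.
Variable a : nat.

Definition complete_rel : rel 'I_a := [rel i j | i != j].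

Lemma complete_sym : symmetric complete_rel.
Proof. by move=> i j; rewrite /complete_rel /= eq_sym. Qed.

Lemma complete_irr : irreflexive complete_rel.
Proof. by move=> i; rewrite /complete_rel /= eqxx. Qed.

Definition complete_graph : sgraph := SGraph complete_sym complete_irr.

End Complete.

(* T_{k,b}: the vertices are the words of length at most b over 'I_k, the root
   is the empty word, and the children of v are the words rcons v i. *)
Section Tree.
Variables k b : nat.

Definition child (v u : b.-bseq 'I_k) : bool :=
  [exists i, (u : seq 'I_k) == rcons v i].

Definition kary_rel : rel (b.-bseq 'I_k) := [rel u v | child u v || child v u].

Lemma kary_sym : symmetric kary_rel.
Proof. by move=> u v; rewrite /kary_rel /= orbC. Qed.

Lemma kary_irr : irreflexive kary_rel.
Proof.
move=> u; rewrite /kary_rel /= orbb; apply/existsP => -[i /eqP/(congr1 size)].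
by rewrite size_rcons => /n_Sn.
Qed.

Definition kary_tree : sgraph := SGraph kary_sym kary_irr.

End Tree.

(* The Cartesian product of two graphs, whose tree edges are the edges in the
   copies of the second factor. *)
Section Box.
Variables K T : sgraph.

Definition box_tree_rel : rel (K * T)%type :=
  [rel p q | (p.1 == q.1) && adj p.2 q.2].

Definition box_rel : rel (K * T)%type :=
  [rel p q | box_tree_rel p q || adj p.1 q.1 && (p.2 == q.2)].

Lemma box_tree_sym : symmetric box_tree_rel.
Proof. by move=> p q; rewrite /box_tree_rel /= eq_sym adj_sym. Qed.

Lemma box_sym : symmetric box_rel.
Proof.
by move=> p q; rewrite /box_rel /box_tree_rel /= [p.1 == _]eq_sym [p.2 == _]eq_sym
                         [adj p.1 _]adj_sym [adj p.2 _]adj_sym.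
Qed.

Lemma box_irr : irreflexive box_rel.
Proof. by move=> p; rewrite /box_rel /box_tree_rel /= !adj_irr andbF. Qed.

Lemma box_tree_adj : subrel box_tree_rel box_rel.
Proof. by move=> p q pq; apply/orP; left. Qed.

Definition box : tgraph :=
  @TGraph (SGraph box_sym box_irr) box_tree_rel box_tree_sym box_tree_adj.

End Box.

(* Main.v *)
Require Import Defs.
From mathcomp Require Import all_boot.
From mathcomp Require Import boolp.

Set Implicit Arguments.
Unset Strict Implicit.
Unset Printing Implicit Defensive.

(* Both sides are equivalent to the existence of a layering of G: a time tau x
   and a chain kap x in 'I_a for every vertex x, such that within a component of
   the graph induced on {tau >= j} each chain gains at most one vertex at time
   j, and a vertex that its chain has left behind in such a component has no
   neighbour there.

   From a forcing process, tau is the propagation time and kap the forcing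
   chain.  A layering places x at the node of the tree whose address lists the
   components of {tau >= 1}, ..., {tau >= tau x} containing x, in the copy
   kap x, and x occupies its copy downward from there until it is replaced;
   conversely, tau x is the depth of the top of the subtree contracted to x.

   From a layering back to a process, in each component the active vertex of
   the chain of w forces w at time tau w.  Time steps perform every valid force
   of the chosen set, so this can fail when a hop becomes valid too early while
   its forcer is idle.  Lowering tau of the earliest such target gives a
   layering again, so a layering with minimal sum of tau never fails. *)

(** * Minima with values in the extended naturals *)

Lemma le_einf (P : nat -> Prop) n :
  le_enat (einf P) n <-> exists2 m, P m & m <= n.
Proof.
rewrite /einf; case: pselect => [exP|nexP] /=.
  case: ex_minnP => m /asboolP Pm m_min; split=> [le_mn|[p Pp le_pn]].
    by exists m.
  by apply: leq_trans le_pn; apply: m_min; apply/asboolP.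
split=> // -[m Pm _]; case: nexP; exists m; exact/asboolP.
Qed.

Lemma einf_some (P : nat -> Prop) m : einf P = Some m -> P m.
Proof.
by rewrite /einf; case: pselect => // exP [<-]; case: ex_minnP => ? /asboolP.
Qed.

(** An upper bound on nested minima needs only one witness at each level, so minimality of [s], [F]
    and [B] drops out. *)
Lemma le_th (G : sgraph) t :
  le_enat (th G) t <->
  exists B F s,
    [/\ @set_of_forces G B F, all_blue_after F s (init B) & #|B| + s <= t].
Proof.
rewrite le_einf; split=> [[n [B [s [ptB ->]]] le_t]|[B [F [s [BF Fs le_t]]]]].
  have [F BF /einf_some Fs] := einf_some ptB.
  by exists B, F, s.
have: le_enat (pt_forces B F) s by apply/le_einf; exists s.
case ptF: (pt_forces B F) => [m|] //= le_ms.
have: le_enat (pt B) m by apply/le_einf; exists m => //; exists F.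
case ptB: (pt B) => [q|] //= le_qm.
exists (#|B| + q); first by exists B, q.
by apply: leq_trans le_t; rewrite leq_add2l (leq_trans le_qm).
Qed.

(** * Contractions and deletions *)

(** A closed form of a sequence of operations: each fibre is contracted to one vertex, hence is
    connected by tree edges. Edges of [H] without counterpart in [G] get deleted, so only the edges
    of [G] have to lift. *)
Record tree_model (H : tgraph) (G : sgraph) (f : H -> G) : Prop := TreeModel {
  model_surj : forall x, exists p, f p = x;
  model_fibre : forall p q, f p = f q ->
    connect [rel p q | tree_edge p q && (f p == f q)] p q;
  model_adj : forall x y, adj x y ->
    exists p q, [/\ f p = x, f q = y & adj p q] }.

Lemma reduces_trans H1 H2 H3 : reduces H1 H2 -> reduces H2 H3 -> reduces H1 H3.
Proof.
move=> H12; elim=> // H' x y _ H1H' xy.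
  exact: Reduces_delete.
exact: Reduces_contract.
Qed.

(** The clause on tree edges carries the induction: a tree edge contracted later must come from a
    tree edge of [H], which then joins the two fibres being united. *)
Lemma reduces_model (H H' : tgraph) : reduces H H' ->
  exists f : H -> H', tree_model f /\
    forall x y, tree_edge x y -> exists p q, [/\ f p = x, f q = y & tree_edge p q].
Proof.
elim=> [|H1 x y _ [f [[fs ff fa] ft]] xy|H1 x y _ [f [[fs ff fa] ft]] xy].
- exists id; split=> [|x y xy]; last by exists x, y.
  split=> [x|p q ->|x y xy]; [by exists x|exact: connect0|by exists x, y].
- exists f; split=> [|u v /andP[/ft//]].
  by split=> // u v /andP[/fa].
have yx : x != y.
  by apply: contraTneq (tree_edge_adj xy) => ->; rewrite adj_irr.
have mP z : Defs.merge x y z != y by rewrite /Defs.merge; case: ifP => [|->].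
pose g p : contract_edge x y := Sub (Defs.merge x y (f p)) (mP _).
have gE p q : (g p == g q) = (Defs.merge x y (f p) == Defs.merge x y (f q)) by [].
have fg p q : connect [rel p q | tree_edge p q && (f p == f q)] p q ->
              connect [rel p q | tree_edge p q && (g p == g q)] p q.
  apply: connect_sub => {}p {}q /andP[pq fpq]; apply: connect1 => /=.
  by rewrite pq gE (eqP fpq) eqxx.
(* Stated for arbitrary relations, to serve both adjacency and tree edges. *)
have lift (e : rel H1) (e' : rel H) (u v : contract_edge x y) :
    (forall u v, e u v -> exists p q, [/\ f p = u, f q = v & e' p q]) ->
    @contr_rel H1 x y e u v -> exists p q, [/\ g p = u, g q = v & e' p q].
  move=> ee' /andP[_ /existsP[u1 /existsP[v1 /and3P[/eqP mu /eqP mv /ee']]]].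
  move=> [p [q [fp fq pq]]]; exists p, q.
  by split=> //; apply: val_inj; rewrite /= ?fp ?fq.
exists g; split; last by move=> u v; exact: lift.
split; last by move=> u v; exact: lift.
- move=> [z zy]; have [p fp] := fs z; exists p; apply: val_inj => /=.
  by rewrite fp /Defs.merge (negPf zy).
have [px [py [fpx fpy pxy]]] := ft _ _ xy.
have gxy : connect [rel p q | tree_edge p q && (g p == g q)] px py.
  by apply: connect1; rewrite /= pxy gE fpx fpy /Defs.merge eqxx (negPf yx) eqxx.
have gsym : connect_sym [rel p q | tree_edge p q && (g p == g q)].
  by apply: sym_connect_sym => p q /=; rewrite tree_edge_sym eq_sym.
(* If exactly one of [p], [q] lies over [y], the path between them crosses from one old fibre to the
   other by the edge [px py]. *)
move=> p q /eqP; rewrite gE /Defs.merge.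
case: (f p =P y) => [fp|_]; case: (f q =P y) => [fq|_] /eqP fpq; try exact/fg/ff.
- by apply/fg/ff; rewrite fp fq.
- apply: (connect_trans (fg p py _)); first by apply: ff; rewrite fp fpy.
  rewrite gsym in gxy; apply: (connect_trans gxy).
  by apply: fg; apply: ff; rewrite fpx.
- apply: (connect_trans (fg p px _)); first by apply: ff; rewrite fpq fpx.
  by apply: (connect_trans gxy); apply: fg; apply: ff; rewrite fq fpy.
Qed.

(** Induction on the number of edges: delete one that [f] does not preserve. When none is left, [f]
    is an isomorphism. *)
Lemma model_inj_obtainable (H : tgraph) (G : sgraph) (f : H -> G) :
  tree_model f -> injective f -> obtainable H G.
Proof.
have [n] := ubnP #|[set p : H * H | adj p.1 p.2]|.
elim: n H f => // n IHn H f lt_n [fs ff fa] f_inj.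
have adjf p q : adj (f p) (f q) -> adj p q.
  by move=> /fa[p' [q' [/f_inj-> /f_inj->]]].
have [/existsP[p /existsP[q /andP[pq npq]]]|] :=
    boolP [exists p, exists q, adj p q && ~~ adj (f p) (f q)].
  have [||H' HH' H'G] := IHn (delete_edge p q) f _ _ f_inj.
  - rewrite -ltnS; apply: leq_trans lt_n; rewrite ltnS; apply: proper_card.
    apply/properP; split; first by apply/subsetP=> e; rewrite !inE => /andP[].
    by exists (p, q); rewrite !inE /= ?pq // /del_rel /= eqxx andbF.
  - split=> // [p' q' /f_inj->|x y xy]; first exact: connect0.
    have [p' [q' [fp' fq' pq']]] := fa x y xy; exists p', q'; split=> //=.
    apply/andP; split=> //; apply: contraNneq npq => e; rewrite -fp' -fq' in xy.
    have: p' \in [set p; q] by rewrite -e !inE eqxx.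
    have: q' \in [set p; q] by rewrite -e !inE eqxx orbT.
    rewrite !inE => /pred2P[] q'E /pred2P[] p'E; rewrite q'E p'E in xy => //.
    + by rewrite adj_irr in xy.
    + by rewrite adj_sym.
    + by rewrite adj_irr in xy.
  - by exists H' => //; apply: reduces_trans HH';
       apply: Reduces_delete pq; exact: Reduces_refl.
move=> /existsPn nadj; exists H; first exact: Reduces_refl.
exists f.
  have [g fg] := choice fs; exists g => // p; exact/f_inj/fg.
move=> p q; apply/idP/idP => [/adjf//|pq].
by have /existsPn/(_ q) := nadj p; rewrite pq negbK.
Qed.

(** Induction on the number of vertices: a fibre with two points is connected by tree edges, so it
    contains one; [f] factors through its contraction. *)
Lemma model_obtainable (H : tgraph) (G : sgraph) (f : H -> G) :
  tree_model f -> obtainable H G.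
Proof.
have [n] := ubnP #|H|; elim: n H f => // n IHn H f lt_n mf.
have [/injectiveP/(model_inj_obtainable mf)//|] := boolP (injectiveb f).
case: mf => fs ff fa /injectivePn[p0 [q0 pq0 fpq0]].
have /existsP[p /existsP[q /and3P[pq tpq /eqP fpq]]] :
    [exists p, exists q, [&& p != q, tree_edge p q & f p == f q]].
  have /connectP[[|p1 s] /= st lst] := ff _ _ fpq0.
    by rewrite lst eqxx in pq0.
  move/andP: st => [/andP[t01 f01] _]; apply/existsP; exists p0.
  apply/existsP; exists p1; rewrite t01 f01 !andbT.
  by apply: contraTneq (tree_edge_adj t01) => ->; rewrite adj_irr.
have fm z : f (Defs.merge p q z) = f z.
  by rewrite /Defs.merge; case: eqP => // ->.
pose g (z : contract_edge p q) := f (val z).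
have mP z : Defs.merge p q z != q by rewrite /Defs.merge; case: ifP => [|->].
pose m z : contract_edge p q := Sub (Defs.merge p q z) (mP _).
have mK (z : contract_edge p q) : m (val z) = z.
  by apply: val_inj; rewrite /= /Defs.merge (negPf (valP z)).
have [||H' HH' H'G] := IHn (contract_edge p q) g.
- rewrite -ltnS; apply: leq_trans lt_n; rewrite ltnS card_sig.
  by rewrite [X in _ < X](cardD1 q) inE add1n ltnS subset_leq_card //;
     apply/subsetP=> z; rewrite !inE andbT.
- split.
  + by move=> x; have [z fz] := fs x; exists (m z); rewrite /g /= fm.
  (* A path in the fibre of [f] is pushed through [m]; steps along the contracted edge become
     stationary. *)
  + move=> u v /ff uv; rewrite -[u]mK -[v]mK.
    move: uv => /connectP[s]; elim: s (val u) => [|z s IHs] z0 /=.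
      by move=> _ ->; exact: connect0.
    move=> /andP[/andP[tz fz] sP] lv.
    apply: connect_trans (IHs _ sP lv).
    have [->|mz] := eqVneq (m z0) (m z); first exact: connect0.
    apply: connect1 => /=; rewrite /g /= !fm fz andbT.
    apply/andP; split=> //; apply/existsP; exists z0; apply/existsP; exists z.
    by rewrite !eqxx.
  + move=> x y xy; have [p' [q' [fp fq pq']]] := fa x y xy.
    exists (m p'), (m q'); split; rewrite /g /= ?fm //.
    apply/andP; split.
      apply: contraTneq xy => e; rewrite -fp -fq -(fm p') -(fm q').
      by rewrite -![Defs.merge p q _]/(val (m _)) e adj_irr.
    apply/existsP; exists p'; apply/existsP; exists q'.
    by rewrite /= !eqxx.
exists H' => //; apply: reduces_trans HH'.
by apply: Reduces_contract tpq; exact: Reduces_refl.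
Qed.

Lemma obtainable_model (H : tgraph) (G : sgraph) :
  obtainable H G <-> exists f : H -> G, tree_model f.
Proof.
split=> [[H' /reduces_model[f [[fs ff fa] _]] [g [h gh hg] gadj]]|[f]].
  have g_inj := can_inj gh.
  exists (g \o f); split.
  - by move=> x; have [p fp] := fs (h x); exists p; rewrite /= fp hg.
  - move=> p q /g_inj/ff; apply: connect_sub => {}p {}q /andP[pq fpq].
    by apply: connect1; rewrite /= pq (eqP fpq) eqxx.
  - move=> x y; rewrite -[x]hg -[y]hg gadj => /fa[p [q [fp fq pq]]].
    by exists p, q; rewrite /= fp fq.
exact: model_obtainable.
Qed.

(** * Layerings and tree models *)

Section Layering.
Variables (G : sgraph) (a : nat).
Implicit Types (tau : G -> nat) (kap : G -> 'I_a).

Definition upper tau j : rel G :=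
  [rel p q | [&& adj p q, j <= tau p & j <= tau q]].

Lemma upper_sym tau j : symmetric (upper tau j).
Proof. by move=> x y; rewrite /upper /= adj_sym; congr (_ && _); exact: andbC. Qed.

Lemma upper_connect_sym tau j : connect_sym (upper tau j).
Proof. exact/sym_connect_sym/upper_sym. Qed.

Lemma connect_upper_anti tau j j' x y : j' <= j ->
  connect (upper tau j) x y -> connect (upper tau j') x y.
Proof.
move=> jj'; apply: connect_sub => p q /and3P[pq jp jq]; apply: connect1.
by rewrite /upper /= pq !(leq_trans jj').
Qed.

(** At time 0 injectivity is global, because initial vertices are active in every component; with
    [layer_base] each chain starts with exactly one vertex. In [layer_replace], [z] takes the place
    of [x] in the component of [y], so the only neighbour [x] may have there is [z] itself. *)
Record layering tau kap : Prop := Layering {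
  layer_inj : forall x y, tau x = tau y ->
    tau x = 0 \/ connect (upper tau (tau x)) x y -> kap x = kap y -> x = y;
  layer_replace : forall x y z, adj x y -> tau x < tau z -> tau z <= tau y ->
    kap z = kap x -> connect (upper tau (tau z)) z y -> z = y;
  layer_base : forall i, exists2 x, tau x = 0 & kap x = i }.

End Layering.

Lemma connect_invariant (T : finType) (e : rel T) (P : T -> Prop) x y :
  (forall p q, e p q -> P p -> P q) -> connect e x y -> P x -> P y.
Proof.
move=> eP /connectP[s]; elim: s x => [|z s IHs] x /=; first by move=> _ ->.
by move=> /andP[xz sP] ly Px; apply: IHs ly _ => //; apply: eP xz Px.
Qed.

Lemma rcons_take_pred (T : Type) (s : seq T) : 0 < size s ->
  exists x, s = rcons (take (size s).-1 s) x.
Proof.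
case/lastP: s => // s x _; exists x.
by rewrite size_rcons -[in take _ _]cats1 take_size_cat.
Qed.

(** * From tree models to layerings *)

Section ModelLayering.
Variables (G : sgraph) (a k b : nat).
Let T := kary_tree k b.
Let H := box (complete_graph a) T.
Implicit Types (f : H -> G) (s : T) (p q : H).

(** Prefixes are ancestors in the tree; the default of [insub_bseq] never occurs, since a prefix of
    [s] is short enough. *)
Definition trunc n s : T := insub_bseq b (take n s).

Lemma val_trunc n s : trunc n s = take n s :> seq _.
Proof.
rewrite /trunc /insub_bseq val_insubd ifT // size_take_min.
exact: leq_trans (geq_minr _ _) (size_bseq s).
Qed.

Lemma trunc_oversize n s : size s <= n -> trunc n s = s.
Proof. by move=> sn; apply: val_inj; rewrite [LHS]val_trunc take_oversize. Qed.

Lemma kary_adjP (s s' : T) :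
  reflect (exists i, s' = rcons s i :> seq _ \/ s = rcons s' i :> seq _) (adj s s').
Proof.
apply: (iffP orP) => [[]/existsP[i /eqP e]|[i []/eqP e]].
- by exists i; left.
- by exists i; right.
- by left; apply/existsP; exists i.
- by right; apply/existsP; exists i.
Qed.

Lemma kary_adj_take (s s' : T) n : adj s s' -> n <= size s -> n <= size s' ->
  take n s = take n s'.
Proof.
by move=> /kary_adjP[i [] ->] ns ns'; rewrite -cats1 takel_cat.
Qed.

Lemma kary_adj_size (s s' : T) : adj s s' -> size s' <= (size s).+1.
Proof. by move=> /kary_adjP[i [] ->]; rewrite size_rcons // ltnW. Qed.

Section FromModel.
Variables (f : H -> G) (mf : tree_model f).

Let rep x : H := sval (cid (model_surj mf x)).

Let top x : H := [arg min_(p < rep x | f p == x) size p.2].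

Let tau x := size (top x).2.
Let kap x : 'I_a := (top x).1.

Let topP x : f (top x) = x /\ forall p, f p = x -> tau x <= size p.2.
Proof.
rewrite /tau /top; case: arg_minnP => [|p /eqP fp min_p].
  exact/eqP/(svalP (cid (model_surj mf x))).
by split=> // q /eqP/min_p.
Qed.

Let f_top x : f (top x) = x. Proof. by case: (topP x). Qed.
Let top_min p : tau (f p) <= size p.2. Proof. by case: (topP (f p)) => _; exact. Qed.

(** A fibre is connected by tree edges, so it stays in one copy of the tree and is a subtree there:
    it lies below its top and contains the path from the top to each of its nodes. All three facts
    propagate along a path that starts at the top. *)
Let fibreP p : [/\ p.1 = kap (f p), take (tau (f p)) p.2 = (top (f p)).2 :> seq _
  & forall n, tau (f p) <= n -> f (kap (f p), trunc n p.2) = f p].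
Proof.
move e: (f p) => z.
pose P q := [/\ f q = z, q.1 = kap z, take (tau z) q.2 = (top z).2 :> seq _
  & forall n, tau z <= n -> f (kap z, trunc n q.2) = z].
have zp : connect [rel p q | tree_edge p q && (f p == f q)] (top z) p.
  by apply: (model_fibre mf); rewrite f_top.
suff: P p by case.
have Pz : P (top z).
  split=> //; first by rewrite take_size.
  by move=> n zn; rewrite trunc_oversize // -surjective_pairing.
apply: (connect_invariant _ zp Pz) => {e zp Pz}p q /andP[/andP[/eqP pq1 pq2] /eqP fpq].
case=> fp p1 takep fpn; rewrite fpq in fp.
have zq : tau z <= size q.2 by rewrite -fp.
have zp : tau z <= size p.2 by rewrite -fp -fpq.
split=> //; first by rewrite -pq1.
  by rewrite -(kary_adj_take pq2).
move=> n zn; have [qn|nq] := leqP (size q.2) n.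
  by rewrite trunc_oversize // -p1 pq1 -surjective_pairing.
rewrite -[RHS](fpn n zn); congr (f (_, _)); apply: val_inj.
rewrite [LHS]val_trunc [RHS]val_trunc (kary_adj_take pq2) //; last exact: ltnW.
by rewrite -ltnS (leq_trans nq) // kary_adj_size.
Qed.

Let box_adj_take p q n : adj p q -> n <= size p.2 -> n <= size q.2 ->
  take n p.2 = take n q.2.
Proof.
by case/orP=> [/andP[_ /kary_adj_take]|/andP[_ /eqP->] //]; exact.
Qed.

(** An edge between vertices of time at least [d] lifts to an edge between nodes of depth at least
    [d], which have the same ancestor at depth [d]. *)
Let upper_take d x y : connect (upper tau d) x y ->
  take d (top x).2 = take d (top y).2.
Proof.
move=> xy.
apply: (connect_invariant (P := fun z => take d (top x).2 = take d (top z).2)) xy _ => //.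
move=> {}x' {}y' /and3P[xy dx dy] ->.
have [p [q [fp fq pq]]] := model_adj mf xy.
have [_ takep _] := fibreP p; have [_ takeq _] := fibreP q.
have dp : d <= size p.2 by apply: leq_trans (top_min p); rewrite fp.
have dq : d <= size q.2 by apply: leq_trans (top_min q); rewrite fq.
rewrite -fp -fq -takep -takeq !take_takel ?fp ?fq //.
exact: box_adj_take.
Qed.

Lemma model_layering : exists tau (kap : G -> 'I_a),
  layering tau kap /\ forall x, tau x <= b.
Proof.
exists tau, kap; split; last by move=> x; exact: size_bseq.
split.
- move=> x y txy sxy kxy; rewrite -[x]f_top -[y]f_top; congr f.
  apply/eqP; rewrite [top x]surjective_pairing [top y]surjective_pairing.
  rewrite xpair_eqE [_.1]kxy eqxx -val_eqE /=; apply/eqP.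
  case: sxy => [tx0|/upper_take]; last by rewrite take_size txy take_size.
  by rewrite [LHS]size0nil // [RHS]size0nil // -[LHS]txy.
- move=> x y z xy xz zy kzx /upper_take; rewrite take_size => topzy.
  have [p [q [fp fq pq]]] := model_adj mf xy.
  have [p1 takep fpn] := fibreP p; have [_ takeq _] := fibreP q.
  have zq : tau z <= size q.2 by rewrite (leq_trans zy) // -fq.
  rewrite -fq -takeq take_takel ?fq // in topzy.
  (* If [p] is at least as deep as the top of [z], that top lies on the path from the top of [x]
     down to [p], so it is in the fibre of [x], forcing [z = x]. Otherwise [p q] is a tree edge that
     enters depth [tau z], and [q] is the top of [z]. *)
  have [zp|pz] := leqP (tau z) (size p.2).
    have: f (kap x, trunc (tau z) p.2) = x by rewrite -{1}fp fpn ?fp // ltnW.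
    have -> : (kap x, trunc (tau z) p.2) = top z.
      rewrite [RHS]surjective_pairing -kzx; congr (_, _).
      by apply: val_inj; rewrite [LHS]val_trunc (box_adj_take pq).
    by rewrite f_top => zx; rewrite zx ltnn in xz.
  case/orP: pq => [/andP[/eqP pq1 pq2]|/andP[_ /eqP pq2]]; last first.
    by rewrite -pq2 leqNgt pz in zq.
  rewrite -[LHS]f_top -fq; congr f.
  rewrite [top z]surjective_pairing [q]surjective_pairing; congr (_, _).
    by rewrite -pq1 p1 fp.
  apply: val_inj; rewrite /= topzy take_oversize //.
  exact: leq_trans (kary_adj_size pq2) pz.
(* The root of copy [i]. *)
- move=> i; pose p : H := (i, trunc 0 (insub_bseq b [::])).
  have p0 : size p.2 = 0 by rewrite /= val_trunc take0.
  exists (f p); last by have [] := fibreP p.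
  by apply/eqP; rewrite -leqn0 -p0.
Qed.

End FromModel.

End ModelLayering.

(** * From layerings to tree models *)

Section LayeringModel.
Variables (G : sgraph) (a b : nat) (tau : G -> nat) (kap : G -> 'I_a).
Hypothesis tau_kap : layering tau kap.
Hypothesis tau_le : forall x, tau x <= b.
Let T := kary_tree #|G| b.
Let H := box (complete_graph a) T.

(** The canonical representative [root] names a component, so an alphabet of size [#|G|] suffices.
    Depth 0 gets no letter: all components share the root of the tree. *)
Let word (z : G) : seq 'I_#|G| :=
  [seq enum_rank (root (upper tau j) z) | j <- iota 1 (tau z)].

Let size_word z : size (word z) = tau z.
Proof. by rewrite size_map size_iota. Qed.

Let take_word d z : d <= tau z ->
  take d (word z) = [seq enum_rank (root (upper tau j) z) | j <- iota 1 d].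
Proof. by move=> dz; rewrite -map_take take_iota (minn_idPl dz). Qed.

Let word_connect d x y : d <= tau x -> d <= tau y ->
  connect (upper tau d) x y -> take d (word x) = take d (word y).
Proof.
move=> dx dy xy; rewrite !take_word //; apply/eq_in_map => j.
rewrite mem_iota add1n ltnS => /andP[_ jd]; congr enum_rank.
apply/eqP; rewrite root_connect; last exact: upper_connect_sym.
exact: connect_upper_anti xy.
Qed.

Let connect_word d x y : 0 < d -> d <= tau x -> d <= tau y ->
  take d (word x) = take d (word y) -> connect (upper tau d) x y.
Proof.
move=> d0 dx dy; rewrite !take_word // => /eq_in_map/(_ d).
rewrite mem_iota add1n ltnS leqnn d0 => /(_ isT)/enum_rank_inj/eqP.
by rewrite root_connect //; exact: upper_connect_sym.
Qed.

Let word_inj x y : kap x = kap y -> word x = word y -> x = y.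
Proof.
move=> kxy wxy; have txy : tau x = tau y by rewrite -!size_word wxy.
apply: (layer_inj tau_kap) => //.
case: (posnP (tau x)) => [|x0]; [by left|right].
by apply: connect_word; rewrite -?txy // wxy.
Qed.

Let base i : G := s2val (cid2 (layer_base tau_kap i)).

(** The vertex occupying node [p]: the latest one of its chain placed at [p] or above. The default
    [base] is always a candidate, as its word is empty. *)
Let f (p : H) : G :=
  [arg max_(z > base p.1 | (kap z == p.1) && (word z == take (tau z) p.2)) tau z].

Let fP p : [/\ kap (f p) = p.1, word (f p) = take (tau (f p)) p.2 &
  forall z, kap z = p.1 -> word z = take (tau z) p.2 -> tau z <= tau (f p)].
Proof.
rewrite /f; case: arg_maxnP => [|z /andP[/eqP kz /eqP wz] z_max].
  rewrite /base; case: cid2 => x /= t0 ->.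
  by rewrite eqxx t0 take0 -size_eq0 size_word t0.
by split=> // z' kz' wz'; apply: z_max; rewrite kz' wz' !eqxx.
Qed.

Let f_eq (p : H) z : kap z = p.1 -> word z = take (tau z) p.2 ->
  (forall z', kap z' = p.1 -> word z' = take (tau z') p.2 -> tau z' <= tau z) ->
  f p = z.
Proof.
move=> kz wz z_max; have [kf wf f_max] := fP p.
apply: word_inj; first by rewrite kf.
rewrite wf wz; congr take; apply/eqP; rewrite eqn_leq f_max // andbT.
exact: z_max.
Qed.

Let pos z : T := insub_bseq b (word z).

Let val_pos z : pos z = word z :> seq _.
Proof. by rewrite /pos /insub_bseq val_insubd ifT // size_word. Qed.

Let f_pos z : f (kap z, pos z) = z.
Proof.
apply: f_eq => //=; first by rewrite val_pos -size_word take_size.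
move=> z' _; rewrite val_pos => wz'; rewrite -!size_word wz' size_take_min.
exact: geq_minr.
Qed.

Lemma layering_model : exists f : H -> G, tree_model f.
Proof.
exists f; split.
- by move=> x; exists (kap x, pos x); exact: f_pos.
- have csym : connect_sym [rel p q | @tree_edge H p q && (f p == f q)].
    apply: sym_connect_sym => p q; congr (_ && _); last exact: eq_sym.
    exact: (@tree_edge_sym H).
  (* Moving up one level keeps the occupant as long as its own node has not been reached. *)
  have to_pos p : connect [rel p q | @tree_edge H p q && (f p == f q)] p
      (kap (f p), pos (f p)).
    have [n] := ubnP (size p.2); elim: n p => // n IHn p lt_n.
    have [kf wf f_max] := fP p.
    have [pz|zp] := leqP (size p.2) (tau (f p)).
      apply: eq_connect0; rewrite [LHS]surjective_pairing kf; congr (_, _).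
      by apply: val_inj; rewrite [RHS]val_pos wf take_oversize.
    pose q : H := (p.1, trunc (size p.2).-1 p.2).
    have p0 : 0 < size p.2 by apply: leq_ltn_trans zp.
    have zq : tau (f p) <= (size p.2).-1 by rewrite -ltnS prednK.
    have fq : f q = f p.
      apply: f_eq => //=; rewrite val_trunc; first by rewrite take_takel.
      move=> z' kz' wz'; apply: f_max => //; rewrite wz' take_takel //.
      by rewrite -size_word wz' !size_take_min !geq_min leqnn !orbT.
    have sq : size q.2 < size p.2.
      by rewrite /= val_trunc size_take_min gtn_min prednK // leqnn.
    rewrite -fq; apply: connect_trans (IHn q (leq_trans sq _)) => //.
    apply: connect1; rewrite /= fq !eqxx andbT /=.
    apply/andP; split=> //; apply/kary_adjP; have [i e] := rcons_take_pred p0.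
    by exists i; right; rewrite val_trunc.
  move=> p q fpq; apply: connect_trans (to_pos p) _.
  by rewrite csym fpq; exact: to_pos.
have main x y : adj x y -> tau x <= tau y ->
    exists p q, [/\ f p = x, f q = y & @adj H p q].
  move=> xy txy.
  have cxy : connect (upper tau (tau x)) x y.
    by apply: connect1; rewrite /upper /= xy leqnn.
  have wxy : word x = take (tau x) (word y).
    by rewrite -(word_connect _ txy cxy) // -size_word take_size.
  (* The node of [x] is an ancestor of the node of [y]. In distinct chains, [x] still occupies its
     own copy at the node of [y]: a replacement [z] would equal [y] by [layer_replace]. *)
  have [kxy|nkxy] := eqVneq (kap x) (kap y); last first.
    exists (kap x, pos y), (kap y, pos y); split; rewrite ?f_pos //; last first.
      by apply/orP; right; apply/andP.
    apply: f_eq; rewrite /= ?val_pos // => z kz wz; rewrite leqNgt.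
    apply/negP => xz; have zy : tau z <= tau y.
      by rewrite -!size_word wz size_take_min geq_minr.
    suff zy' : z = y by rewrite -kz zy' eqxx in nkxy.
    apply: (layer_replace tau_kap xy) => //.
    apply: connect_word => //; first exact: leq_ltn_trans xz.
    by rewrite -wz -size_word take_size.
  have lt_xy : tau x < tau y.
    rewrite ltn_neqAle txy andbT; apply: contraTneq xy => e.
    by rewrite (layer_inj tau_kap e _ kxy) ?adj_irr //; right.
  have y0 : 0 < tau y by apply: leq_ltn_trans lt_xy.
  (* In a common chain, [y] takes over at its own node and [x] occupies the parent of that node, so
     the edge is a tree edge. *)
  exists (kap x, trunc (tau y).-1 (pos y)), (kap y, pos y).
  split; [|exact: f_pos|].
    apply: f_eq; rewrite /= ?val_trunc ?val_pos //.
      by rewrite take_takel // -ltnS prednK.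
    move=> z kz; have [zy|yz] := leqP (tau z) (tau y).-1; last first.
      move=> /(congr1 size); rewrite size_word !size_take_min => e.
      by rewrite e !ltn_min ltnn !andbF in yz.
    rewrite take_takel // => wz; rewrite leqNgt; apply/negP => xz.
    have zy' : tau z <= tau y by rewrite (leq_trans zy) // leq_pred.
    suff zyE : z = y by rewrite zyE -ltnS prednK // ltnn in zy.
    apply: (layer_replace tau_kap xy) => //.
    apply: connect_word => //; first exact: leq_ltn_trans xz.
    by rewrite -wz -size_word take_size.
  apply/orP; left; apply/andP; split; [exact/eqP|apply/kary_adjP].
  rewrite -size_word in y0; have [i e] := rcons_take_pred y0.
  by exists i; left; rewrite val_trunc val_pos -size_word.
move=> x y xy; have [|/ltnW yx] := leqP (tau x) (tau y); first exact: main.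
rewrite adj_sym in xy; have [p [q [fp fq pq]]] := main y x xy yx.
by exists q, p; rewrite adj_sym.
Qed.

End LayeringModel.

(** * Invariants of the forcing process *)

Section WhiteComponents.
Variable G : sgraph.
Implicit Types (B : {set G}) (x y z : G).

Lemma white_comp_refl B x : x \in white_comp B x.
Proof. by rewrite inE connect0. Qed.

Lemma white_comp_sym B x y : (y \in white_comp B x) = (x \in white_comp B y).
Proof.
rewrite !inE; apply: sym_connect_sym => p q /=.
by rewrite adj_sym; congr (_ && _); exact: andbC.
Qed.

Lemma white_comp_trans B x y z :
  y \in white_comp B x -> z \in white_comp B y -> z \in white_comp B x.
Proof. by rewrite !inE; exact: connect_trans. Qed.

Lemma white_comp_adj B x y :
  x \notin B -> y \notin B -> adj x y -> y \in white_comp B x.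
Proof. by move=> xB yB xy; rewrite inE connect1 //= xy xB. Qed.

Lemma white_comp_white B x y :
  x \notin B -> y \in white_comp B x -> y \notin B.
Proof.
move=> xB; rewrite inE => xy.
by apply: (connect_invariant (P := fun z => z \notin B) _ xy) => // p q /and3P[].
Qed.

Lemma white_comp_anti B B' x y :
  B \subset B' -> y \in white_comp B' x -> y \in white_comp B x.
Proof.
move=> /subsetP sBB'; rewrite !inE; apply: connect_sub => p q /and3P[pq pB qB].
by rewrite connect1 //= pq !(contraNN (sBB' _)).
Qed.

End WhiteComponents.

Section Invariant.
Variables (G : sgraph) (a : nat).
Implicit Types (c : config G) (kap : G -> 'I_a) (S : seq (G * G)).

(** [active_nbr] is the point where validity enters: a vertex becomes inactive only by a force,
    after which it has no white neighbour left in that component. *)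
Record chain_inv kap c : Prop := ChainInv {
  active_sub : forall x, x \notin blue c -> active c x \subset blue c;
  active_comp : forall x y, x \notin blue c -> y \in white_comp (blue c) x ->
    active c y = active c x;
  active_nbr : forall u x, x \notin blue c -> u \in blue c -> adj u x ->
    u \in active c x;
  active_inj : forall x, x \notin blue c -> {in active c x &, injective kap} }.

(** Kept apart from [chain_inv]: it provides a forcer for each target when a process is built from a
    layering. *)
Definition chain_full kap c :=
  forall x i, x \notin blue c -> exists2 u, u \in active c x & kap u = i.

Lemma chain_inv_eq kap kap' c : {in blue c, kap =1 kap'} ->
  chain_inv kap c -> chain_inv kap' c.
Proof.
move=> e [cs cc cn ci]; split=> // x xc u v ux vx.
by rewrite -!e; [exact: ci xc u v ux vx|exact: (subsetP (cs x xc))..].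
Qed.

Lemma blue_perform c f : blue (perform c f) = f.2 |: blue c.
Proof. by case: f. Qed.

Lemma validP c u w :
  reflect [/\ w \notin blue c, u \in active c w & forall v, adj u v ->
             v \in white_comp (blue c) w -> v \notin blue c -> v = w]
          (valid c u w).
Proof.
apply: (iffP and3P) => -[wc uw nb]; split=> //.
  move=> v uv vw vc; apply: contraNeq vc => vw'; move/forallP/(_ v): nb.
  by rewrite !inE vw' in vw *; rewrite vw uv.
apply/forallP=> v; apply/implyP; rewrite in_setD1 in_setU => /andP[vw vW].
apply/implyP => uv; apply: contraNT vw => vc; rewrite (negPf vc) orbF in vW.
exact/eqP/nb.
Qed.

(** In the component of [w], the new active vertex [w] takes the place of [u] in the same chain, and
    validity leaves [u] no white neighbour there other than [w]. *)
Lemma perform_inv kap c u w : valid c u w -> kap w = kap u ->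
  chain_inv kap c -> chain_inv kap (perform c (u, w)).
Proof.
case/validP=> wc uw nb kwu [cs cc cn ci].
have sub x y : y \in white_comp (w |: blue c) x -> y \in white_comp (blue c) x.
  exact/white_comp_anti/subsetUr.
split=> /=.
- move=> x; rewrite !inE negb_or => /andP[xw xc]; case: ifP => _.
    by rewrite setUS // (subset_trans (subsetDl _ _)) ?cs.
  exact: subset_trans (cs x xc) (subsetUr _ _).
- move=> x y; rewrite in_setU1 negb_or => /andP[xw xc] /sub xy.
  rewrite (cc x y) //; congr (if _ then _ else _).
  apply/idP/idP => [wy|wx]; last exact: white_comp_trans wx xy.
  by apply: white_comp_trans wy _; rewrite white_comp_sym.
- move=> u' x; rewrite in_setU1 negb_or => /andP[xw xc].
  rewrite in_setU1 => /predU1P[->|u'c] u'x.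
    by rewrite white_comp_adj // setU11.
  case: ifPn => wx; last exact: cn.
  rewrite in_setU1 in_setD1 cn // andbT; apply/orP; right.
  by apply: contraNneq xw => u'u; rewrite u'u in u'x; rewrite (nb x).
- move=> x; rewrite in_setU1 negb_or => /andP[xw xc].
  case: ifPn => wx; last exact: ci.
  have ux : u \in active c x by rewrite (cc w x).
  move=> p q; rewrite !in_setU1 !in_setD1 => /predU1P[->|/andP[pu px]].
    move=> /predU1P[->//|/andP[qu qx]]; rewrite kwu => e.
    by have uq := ci x xc u q ux qx e; rewrite uq eqxx in qu.
  move=> /predU1P[->|/andP[qu qx]]; last exact: ci xc p q px qx.
  by rewrite kwu => e; have pu' := ci x xc p u px ux e; rewrite pu' eqxx in pu.
Qed.

Lemma perform_full kap c u w : kap w = kap u ->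
  chain_full kap c -> chain_full kap (perform c (u, w)).
Proof.
move=> kwu cf x i /=; rewrite in_setU1 negb_or => /andP[_ xc].
have [v vx kv] := cf x i xc; case: ifP => _; last by exists v.
have [vu|vu] := eqVneq v u; last by exists v; rewrite // !inE vu vx orbT.
by exists w; rewrite ?setU11 // kwu -vu.
Qed.

(** Conditions under which forces valid at [c] remain valid when performed one after the other, so
    that a simultaneous step can be serialised. *)
Definition independent c S : Prop :=
  [/\ uniq [seq f.2 | f <- S], {in S, forall f, valid c f.1 f.2} &
      {in S &, forall f g, f.1 = g.1 -> g.2 \in white_comp (blue c) f.2 ->
        f = g}].

(** Components only shrink, and a forcer loses activity only in the component it forces into, where
    by independence it has no second target. *)
Lemma perform_independent c f S :
  independent c (f :: S) -> independent (perform c f) S.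
Proof.
case: f => u w [/andP[/= wS uS] vS iS].
have sub x y : y \in white_comp (w |: blue c) x -> y \in white_comp (blue c) x.
  exact/white_comp_anti/subsetUr.
split=> //= [[u' w'] fS|f g fS gS fg /sub fg']; last first.
  by apply: (iS f g _ _ fg fg'); rewrite inE ?fS ?gS orbT.
have fS' : (u', w') \in (u, w) :: S by rewrite inE fS orbT.
have w'w : w' != w.
  by apply: contraNneq wS => <-; apply/mapP; exists (u', w').
have /validP[/= w'c u'w' nb] := vS _ fS'.
apply/validP; split=> /=; first by rewrite in_setU1 negb_or w'w.
  case: ifP => // ww'; rewrite in_setU1 in_setD1 u'w' andbT; apply/orP; right.
  apply: contra_neq w'w => u'u.
  by have := iS _ _ (mem_head _ _) fS' (esym u'u) ww'; case.
move=> v u'v /sub vw'; rewrite in_setU1 negb_or => /andP[_]; exact: nb.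
Qed.

Lemma blue_foldl c S : blue (foldl (@perform G) c S) = blue c :|: [set f.2 | f in S].
Proof.
elim: S c => [|f S IHS] c /=.
  by apply/setP=> x; rewrite !inE orb_idr // => /imsetP[].
rewrite IHS blue_perform; apply/setP=> x; rewrite !inE -orbA orbCA; congr (_ || _).
apply/orP/imsetP => [[/eqP->|/imsetP[g gS ->]]|[g]].
- by exists f; rewrite ?mem_head.
- by exists g; rewrite // inE gS orbT.
- by rewrite inE => /predU1P[-> ->|gS ->]; [left|right; apply/imsetP; exists g].
Qed.

Lemma foldl_inv kap c S : independent c S ->
  {in S, forall f, kap f.2 = kap f.1} ->
  chain_inv kap c -> chain_inv kap (foldl (@perform G) c S).
Proof.
elim: S c => //= -[u w] S IHS c iS kS ci.
apply: IHS; first exact: perform_independent iS.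
  by move=> f fS; apply: kS; rewrite inE fS orbT.
have [_ /(_ _ (mem_head _ _)) /= vuw _] := iS.
exact: perform_inv vuw (kS _ (mem_head _ _)) ci.
Qed.

Lemma foldl_full kap c S : {in S, forall f, kap f.2 = kap f.1} ->
  chain_full kap c -> chain_full kap (foldl (@perform G) c S).
Proof.
elim: S c => //= -[u w] S IHS c kS cf.
apply: IHS; first by move=> f fS; apply: kS; rewrite inE fS orbT.
by apply: perform_full cf; exact: (kS _ (mem_head _ _)).
Qed.

Lemma foldl_chronological c S L : independent c S ->
  chronological (foldl (@perform G) c S) L -> chronological c (S ++ L).
Proof.
elim: S c => //= f S IHS c iS chL; split.
  by have [_ /(_ _ (mem_head _ _))] := iS.
exact: IHS (perform_independent iS) chL.
Qed.

(** Only newly forced vertices enter active sets, so activity of an old blue vertex can be traced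
    back in time. *)
Lemma foldl_active c S u x : {in S, forall f, f.2 \notin blue c} ->
  u \in blue c -> u \in active (foldl (@perform G) c S) x -> u \in active c x.
Proof.
move=> Sc uc; have : {in S, forall f, f.2 != u}.
  by move=> f fS; apply: contraNneq (Sc f fS) => ->.
elim: S c {Sc uc} => //= -[v w] S IHS c Su.
move=> /IHS -/(_ (fun f fS => Su f (mem_behead (s := _ :: _) fS))) /=.
case: ifP => // _; rewrite in_setU1 in_setD1 => /predU1P[uw|/andP[]//].
by have := Su _ (mem_head _ _); rewrite uw eqxx.
Qed.

Lemma chronological_targets c (L : seq (G * G)) : chronological c L ->
  uniq [seq f.2 | f <- L] /\ {in L, forall f, f.2 \notin blue c}.
Proof.
elim: L c => //= f L IHL c [vf /IHL[uL Lc]].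
have {Lc} Lc g : g \in L -> g.2 != f.2 /\ g.2 \notin blue c.
  by move/Lc; rewrite blue_perform in_setU1 negb_or => /andP.
split.
  rewrite uL andbT; apply/mapP => -[g /Lc[gf _] fg].
  by rewrite fg eqxx in gf.
by move=> g; rewrite inE => /predU1P[->|/Lc[]//]; case/validP: vf.
Qed.

(** A vertex turns blue only once in a chronological list. This makes the chain of a vertex well
    defined. *)
Lemma set_of_forces_target (B : {set G}) F u u' w : set_of_forces B F ->
  (u, w) \in F -> (u', w) \in F -> u = u'.
Proof.
case=> L /chronological_targets[uL _] ->; rewrite !inE => uF u'F.
suff: (u, w) = (u', w) by case.
elim: L uL uF u'F => //= f L IHL /andP[fL uL]; rewrite !inE.
move=> /predU1P[uf|uF] /predU1P[u'f|u'F]; first by rewrite uf.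
- by case/mapP: fL; exists (u', w); rewrite -?uf.
- by case/mapP: fL; exists (u, w); rewrite -?u'f.
- exact: IHL.
Qed.

End Invariant.

Lemma white_comp_upper (G : sgraph) (tau : G -> nat) (B : {set G}) d x y :
  B = [set z | tau z <= d] ->
  (y \in white_comp B x) = connect (upper tau d.+1) x y.
Proof.
move=> ->; rewrite inE; apply: eq_connect => p q.
by rewrite /upper /= !inE -!ltnNge.
Qed.

(** * From forces to layerings *)

Section ForcesLayering.
Variables (G : sgraph) (a : nat) (F : {set G * G}).
Hypothesis F_target : forall u u' w, (u, w) \in F -> (u', w) \in F -> u = u'.
Implicit Types (c : config G) (tau : G -> nat) (kap : G -> 'I_a).

(** The state after [d] steps: blue vertices have their final time, and white ones carry the
    placeholder [d.+1], so the layering conditions are imposed only up to time [d]. *)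
Record layering_upto d tau kap : Prop := LayeringUpto {
  upto_inj : forall x y, tau x = tau y -> tau x <= d ->
    tau x = 0 \/ connect (upper tau (tau x)) x y -> kap x = kap y -> x = y;
  upto_replace : forall x y z, adj x y -> tau x < tau z -> tau z <= tau y ->
    tau z <= d -> kap z = kap x -> connect (upper tau (tau z)) z y -> z = y;
  upto_base : forall i, exists2 x, tau x = 0 & kap x = i;
  upto_le : forall x, tau x <= d.+1 }.

Lemma time_step_layering d tau kap c c' :
  blue c = [set x | tau x <= d] -> chain_inv kap c ->
  layering_upto d tau kap -> time_step F c c' ->
  exists tau' kap', [/\ blue c' = [set x | tau' x <= d.+1], chain_inv kap' c' &
    layering_upto d.+1 tau' kap'].
Proof.
move=> bc ci [l1 l2 l3 l4] [S [uS vS iS _ c'E]].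
have iS' : independent c S.
  split.
  - rewrite map_inj_in_uniq // => -[u w] [u' w'] uwS uwS' /= ww'.
    rewrite -{}ww' in uwS' *; congr (_, _).
    by apply: (F_target (w := w)); [case: (vS u w)|case: (vS u' w)].
  - by move=> [u w] /vS[].
  - move=> [u w] [u' w'] uwS uwS' /= uu' ww'; rewrite -{}uu' in uwS' *.
    by rewrite (iS u w w').
have white x : (x \in blue c) = (tau x <= d) by rewrite bc inE.
have bc' := blue_foldl c S; rewrite -c'E in bc'.
have sbc' : blue c \subset blue c' by rewrite bc' subsetUl.
(* Newly forced vertices settle at [d.+1] in the chain of their forcer; the placeholder of the
   others moves to [d.+2]. Components at levels up to [d.+1] are unaffected. *)
pose tau' x := if x \in blue c then tau x
               else if x \in blue c' then d.+1 else d.+2.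
pose kap' x := if x \in blue c then kap x
               else if [pick u | (u, x) \in S] is Some u then kap u else kap x.
have tauE j x : j <= d.+1 -> (j <= tau' x) = (j <= tau x).
  rewrite /tau' white => jd; case: (leqP (tau x) d) => // dx; rewrite (leq_trans jd dx).
  by case: ifP => // _; exact: leq_trans jd _.
have upperE j : j <= d.+1 -> connect (upper tau' j) =2 connect (upper tau j).
  by move=> jd; apply: eq_connect => p q; rewrite /upper /= !tauE.
have tau'E x : x \in blue c -> tau' x = tau x by rewrite /tau' => ->.
have kap'E x : x \in blue c -> kap' x = kap x by rewrite /kap' => ->.
have Sw u w : (u, w) \in S -> [/\ u \in blue c, w \notin blue c & kap' w = kap u].
  move=> uw; have [_ vuw] := vS _ _ uw; have [wc uac _] := validP _ _ _ vuw.
  split=> //; first by rewrite (subsetP (active_sub ci wc)).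
  rewrite /kap' (negPf wc); case: pickP => [u' u'w|/(_ u)]; last by rewrite uw.
  by congr kap; apply: (F_target (w := w)); [case: (vS u' w)|case: (vS u w)].
have new x : tau' x = d.+1 -> exists2 u, (u, x) \in S & x \notin blue c.
  rewrite /tau'; case: ifPn => xc.
    by move=> e; rewrite white e ltnn in xc.
  case: ifPn => [|_ /eqP]; last by rewrite eqSS gtn_eqF.
  by rewrite bc' inE (negPf xc) => /imsetP[[u w] uw /= ->]; exists u.
have old x : tau' x <= d -> x \in blue c.
  rewrite /tau'; case: ifP => // _; case: ifP => _; last by rewrite ltnNge leqnSn.
  by rewrite ltnn.
exists tau', kap'; split.
- apply/setP=> x; rewrite inE /tau'; case: ifPn => xc.
    by rewrite (subsetP sbc') // leqW // -white.
  by case: ifPn => // _; rewrite ?leqnn ?ltnn.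
- rewrite c'E; apply: foldl_inv => //.
    by move=> [u w] /Sw[uc _ /= ->]; rewrite kap'E.
  by apply: chain_inv_eq ci => x xc; rewrite kap'E.
split.
- move=> x y txy; rewrite leq_eqVlt ltnS => /predU1P[tx|txd]; last first.
    rewrite upperE ?(leqW txd) //.
    have xc := old _ txd; have yc : y \in blue c by apply: old; rewrite -txy.
    by rewrite !tau'E // !kap'E // in txy txd *; exact: l1.
  (* Two new vertices of one chain in one component have the same forcer, which performs a single
     force there per step. *)
  rewrite tx upperE // -(white_comp_upper _ _ bc) => -[//|yx].
  have [u ux xc] := new x tx; have [v vy yc] := new y (etrans (esym txy) tx).
  have [uc _ ->] := Sw _ _ ux; have [vc _ ->] := Sw _ _ vy => kuv.
  have [_ /validP[_ uax _]] := vS _ _ ux; have [_ /validP[_ vay _]] := vS _ _ vy.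
  rewrite (active_comp ci xc yx) in vay.
  have e := active_inj ci xc uax vay kuv; rewrite -e in vy.
  by rewrite (iS _ _ _ ux vy).
- move=> x y z xy xz zy; rewrite leq_eqVlt ltnS => /predU1P[tz|tzd]; last first.
    have zc := old _ tzd; have xc := old _ (ltnW (leq_trans xz tzd)).
    rewrite upperE ?(leqW tzd) // !kap'E //.
    rewrite tauE ?(leqW tzd) // in zy; rewrite !tau'E // in xz tzd zy *.
    exact: l2.
  (* As a blue neighbour of [y], [x] is active in this component, hence is the forcer of [z];
     validity then gives [y = z]. *)
  rewrite tz upperE // -(white_comp_upper _ _ bc) => kzx yz.
  have [u uz zc] := new z tz; have [uc _ kzE] := Sw _ _ uz.
  rewrite tz ltnS in xz; have xc := old _ xz.
  have [_ /validP[_ uaz nb]] := vS _ _ uz.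
  have yc := white_comp_white zc yz.
  have xaz : x \in active c z by rewrite -(active_comp ci zc yz) (active_nbr ci).
  rewrite kzE kap'E // in kzx; have ux := active_inj ci zc uaz xaz kzx.
  by rewrite ux in nb; rewrite (nb y).
- move=> i; have [x tx kx] := l3 i.
  by have xc : x \in blue c; rewrite ?white ?tx //; exists x; rewrite ?tau'E ?kap'E.
- move=> x; rewrite /tau' white; case: (leqP (tau x) d) => [/leqW/leqW//|_].
  by case: ifP.
Qed.

Lemma all_blue_layering s d tau kap c :
  blue c = [set x | tau x <= d] -> chain_inv kap c ->
  layering_upto d tau kap -> all_blue_after F s c ->
  exists tau' kap', @layering G a tau' kap' /\ forall x, tau' x <= d + s.
Proof.
elim: s d tau kap c => [|s IHs] d tau kap c bc ci lay /=.
  move=> cT; have tau_le x : tau x <= d.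
    by have := in_setT x; rewrite -cT bc inE.
  exists tau, kap; rewrite addn0; split=> //; split; last exact: upto_base lay.
    by move=> x y txy; exact: upto_inj lay _ _ txy (tau_le x).
  by move=> x y z xy xz zy; exact: upto_replace lay _ _ _ xy xz zy (tau_le z).
move=> [c' cc' c's]; rewrite addnS -addSn.
have [tau' [kap' [bc' ci' lay']]] := time_step_layering bc ci lay cc'.
exact: IHs bc' ci' lay' c's.
Qed.

End ForcesLayering.

Lemma forces_layering (G : sgraph) (B : {set G}) F s :
  set_of_forces B F -> all_blue_after F s (init B) -> 0 < #|B| ->
  exists tau (kap : G -> 'I_#|B|), layering tau kap /\ forall x, tau x <= s.
Proof.
move=> BF Fs /card_gt0P[x0 x0B].
(* The boolean is read as a number: 0 on [B], and the placeholder 1 on white vertices. *)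
pose tau x : nat := x \notin B; pose kap := enum_rank_in x0B.
have tau0 x : (tau x <= 0) = (x \in B) by rewrite /tau; case: (x \in B).
have FT := fun u u' w => @set_of_forces_target G B F u u' w BF.
apply: (all_blue_layering FT (d := 0) (tau := tau) (kap := kap) _ _ _ Fs).
- by apply/setP=> x; rewrite inE tau0.
- by split=> //= x _; exact: (can_in_inj (enum_rankK_in x0B)).
split.
- move=> x y txy; rewrite tau0 => xB _.
  by apply: (can_in_inj (enum_rankK_in x0B)) => //; rewrite -tau0 -txy tau0.
- by move=> x y z _ xz _; rewrite leqNgt (leq_ltn_trans _ xz).
- move=> i; exists (enum_val i); last exact: enum_valK_in.
  by rewrite /tau enum_valP.
- by move=> x; rewrite /tau; case: (_ \notin _).
Qed.

Lemma all_blue_set0 (G : sgraph) (F : {set G * G}) s :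
  all_blue_after F s (init set0) -> [set: G] = set0.
Proof.
elim: s => [<- //|s IHs] /= [c' [S [_ vS _ _ ->]]].
by case: S vS => [//|[u w] S] /(_ u w (mem_head _ _))[_ /validP[_]]; rewrite inE.
Qed.

(** * From layerings to forces *)

Section LayeringForces.
Variables (G : sgraph) (a : nat) (kap : G -> 'I_a).
Implicit Types (c : config G) (tau : G -> nat).

(** The default [z] is not reached for white [z] once [chain_full] holds. *)
Definition forcer c z : G := odflt z [pick u in active c z | kap u == kap z].

Lemma forcerP c z : chain_full kap c -> z \notin blue c ->
  forcer c z \in active c z /\ kap (forcer c z) = kap z.
Proof.
move=> cf zc; rewrite /forcer; case: pickP => [u /andP[uz /eqP]//|nou].
by have [u uz kuz] := cf z (kap z) zc; have := nou u; rewrite uz kuz eqxx.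
Qed.

Lemma forcer_eq c u z : chain_inv kap c -> z \notin blue c ->
  u \in active c z -> kap u = kap z -> forcer c z = u.
Proof.
move=> ci zc uz kuz; rewrite /forcer; case: pickP => [v /andP[vz /eqP kvz]|/(_ u)].
  by apply: (active_inj ci zc) => //; rewrite kvz.
by rewrite uz kuz eqxx.
Qed.

Section Schedule.
Variable tau : G -> nat.
Hypothesis lay : layering tau kap.

Definition layer_forces c d : seq (G * G) :=
  [seq (forcer c z, z) | z <- enum [pred z | tau z == d.+1]].

(** The run prescribed by [tau], defined without reference to a set of forces; whether actual time
    steps follow it is a separate question. *)
Fixpoint schedule d : config G :=
  if d is d'.+1 then
    foldl (@perform G) (schedule d') (layer_forces (schedule d') d')
  else init [set x | tau x == 0].

Lemma layer_forcesP c d u w :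
  reflect (tau w = d.+1 /\ u = forcer c w) ((u, w) \in layer_forces c d).
Proof.
apply: (iffP mapP) => [[z]|[tw ->]].
  by rewrite mem_enum inE => /eqP tz [-> ->].
by exists w; rewrite // mem_enum inE tw.
Qed.

Definition on_schedule d c := [/\ blue c = [set x | tau x <= d],
  chain_inv kap c & chain_full kap c].

(** This is [layer_replace] with [w] as the replacing vertex: a white neighbour of its forcer in the
    component must be [w]. *)
Lemma on_schedule_valid d c w : on_schedule d c -> tau w = d.+1 ->
  valid c (forcer c w) w.
Proof.
move=> [bc ci cf] tw; have wc : w \notin blue c by rewrite bc inE tw ltnn.
have [fw kfw] := forcerP cf wc; apply/validP; split=> // y fy yw yc.
apply/esym/(layer_replace lay fy); rewrite ?tw.
- by have := subsetP (active_sub ci wc) _ fw; rewrite bc inE ltnS.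
- by rewrite bc inE -ltnNge in yc.
- by [].
- by rewrite -(white_comp_upper _ _ bc).
Qed.

Lemma on_schedule_independent d c : on_schedule d c ->
  independent c (layer_forces c d).
Proof.
move=> cd; have [bc ci cf] := cd.
have white x : tau x = d.+1 -> x \notin blue c by move=> tx; rewrite bc inE tx ltnn.
split.
- by rewrite -map_comp map_id enum_uniq.
- by move=> [u w] /layer_forcesP[tw ->] /=; exact: on_schedule_valid cd tw.
move=> [u w] [u' w'] /layer_forcesP[tw uE] /layer_forcesP[tw' u'E] /= uu' ww'.
rewrite uu'; congr (_, _); apply: (layer_inj lay); first by rewrite tw tw'.
  by right; rewrite tw -(white_comp_upper _ _ bc).
have [_ <-] := forcerP cf (white _ tw); have [_ <-] := forcerP cf (white _ tw').
by rewrite -uE -u'E uu'.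
Qed.

Lemma schedule_on d : on_schedule d (schedule d).
Proof.
elim: d => [|d IHd] /=.
  have eq0 x : (x \in [set x | tau x == 0]) = (tau x == 0) by rewrite inE.
  split=> /=; first by apply/setP=> x; rewrite !inE leqn0.
    split=> //= x _ u v; rewrite !eq0 => /eqP u0 /eqP v0.
    by apply: (layer_inj lay); [rewrite u0|left].
  by move=> x i _; have [u u0 ku] := layer_base lay i; exists u; rewrite //= eq0 u0.
have iS := on_schedule_independent IHd; have [bc ci cf] := IHd.
have kS : {in layer_forces (schedule d) d, forall f, kap f.2 = kap f.1}.
  move=> [u w] /layer_forcesP[tw ->] /=.
  by have [] := forcerP cf (z := w); rewrite // bc inE tw ltnn.
split; [|exact: foldl_inv|exact: foldl_full].
apply/setP=> x; rewrite blue_foldl bc !inE [RHS]leq_eqVlt ltnS orbC; congr (_ || _).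
apply/imsetP/eqP => [[[u w] /layer_forcesP[tw _] ->//]|tx].
by exists (forcer (schedule d) x, x) => //; apply/layer_forcesP.
Qed.

Lemma white_schedule d x : (x \notin blue (schedule d)) = (d < tau x).
Proof. by have [-> _ _] := schedule_on d; rewrite inE ltnNge. Qed.

Lemma schedule_comp d x y :
  (y \in white_comp (blue (schedule d)) x) = connect (upper tau d.+1) x y.
Proof. by have [bc _ _] := schedule_on d; exact: white_comp_upper. Qed.

Lemma schedule_active d n u x : u \in blue (schedule d) ->
  u \in active (schedule (d + n)) x -> u \in active (schedule d) x.
Proof.
move=> ud; elim: n => [|n IHn]; first by rewrite addn0.
rewrite addnS /= => /foldl_active uf; apply/IHn/uf.
  move=> [v w] /layer_forcesP[tw _] /=.
  by rewrite white_schedule tw.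
have [bc _ _] := schedule_on (d + n); have [bd _ _] := schedule_on d.
by rewrite bd bc !inE in ud *; rewrite (leq_trans ud) ?leq_addr.
Qed.

Lemma schedule_chronological d n L :
  chronological (schedule (d + n)) L ->
  chronological (schedule d)
    (flatten [seq layer_forces (schedule e) e | e <- iota d n] ++ L).
Proof.
elim: n d => [|n IHn] d; first by rewrite addn0.
rewrite addnS -addSn => /IHn chL; rewrite /= -catA.
exact: foldl_chronological (on_schedule_independent (schedule_on d)) chL.
Qed.

(* Such a force is valid at time d, but the time step from d to d + 1 performs
   no force of u into that component, against the definition of [time_step]. *)
Definition premature d u w := [&& d.+1 < tau w, u == forcer (schedule (tau w).-1) w,
  valid (schedule d) u w &
  [forall z, (tau z == d.+1) ==> (forcer (schedule d) z == u) ==>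
     ~~ connect (upper tau d.+1) w z]].

(** [F] collects all scheduled forces. A time step must serve every valid force of [F]; if none is
    premature, a force that is valid ahead of its turn has a forcer already busy in that component,
    so the scheduled layer is a legal step. *)
Lemma schedule_all_blue b : (forall x, tau x <= b) ->
  (forall d u w, ~~ premature d u w) ->
  exists2 F, set_of_forces [set x | tau x == 0] F &
    all_blue_after F b (init [set x | tau x == 0]).
Proof.
move=> tau_le nprem.
pose L := flatten [seq layer_forces (schedule e) e | e <- iota 0 b].
have memL u w : (u, w) \in L ->
    0 < tau w /\ u = forcer (schedule (tau w).-1) w.
  by move=> /flatten_mapP[d _ /layer_forcesP[-> ->]].
have inL d u w : tau w = d.+1 -> u = forcer (schedule d) w -> (u, w) \in L.
  move=> tw uE; apply/flatten_mapP; exists d; last exact/layer_forcesP.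
  by rewrite mem_iota -tw tau_le.
have blue_b : blue (schedule b) = [set: G].
  by have [-> _ _] := schedule_on b; apply/setP=> x; rewrite !inE tau_le.
exists [set f in L].
  exists L => //; rewrite -[L]cats0; apply: (@schedule_chronological 0 b).
  by rewrite add0n => u w; apply/negP => /validP[]; rewrite blue_b inE.
suff main n d : d + n = b -> all_blue_after [set f in L] n (schedule d).
  exact: (main b 0).
elim: n d => [|n IHn] d; first by rewrite addn0 => ->.
rewrite addnS -addSn => /IHn dn; exists (schedule d.+1) => //.
have don := schedule_on d; have [uS vS iS] := on_schedule_independent don.
exists (layer_forces (schedule d) d); split=> //.
- exact: map_uniq uS.
- move=> u w uw; split; last exact: vS _ uw.
  by rewrite inE; have /layer_forcesP[tw uE] := uw; exact: inL tw uE.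
- by move=> u w w' uw uw' ww'; have [] := iS _ _ uw uw' erefl ww'.
move=> u w; rewrite inE => /memL[w0 uE] vuw.
have dw : d < tau w by rewrite -white_schedule; case/validP: vuw.
have [tw|tw] := eqVneq (tau w) d.+1.
  exists w; last exact: white_comp_refl.
  by apply/layer_forcesP; rewrite uE tw.
have := nprem d u w; rewrite /premature ltn_neqAle eq_sym tw dw uE eqxx -uE vuw /=.
case/forallPn => z; rewrite !negb_imply andbT => /and3P[/eqP tz /eqP uz wz].
by exists z; [apply/layer_forcesP|rewrite schedule_comp].
Qed.

(** At time [d] the vertex [u] is idle and may force [w], so [w] can be given time [d.+1].
    Minimality of [tau w] is needed for neighbours of [w], which sees its replacement in the chain
    earlier than before. *)
Lemma lower_premature d u w :
  premature d u w -> (forall z, premature d u z -> tau w <= tau z) ->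
  layering (fun x => if x == w then d.+1 else tau x) kap.
Proof.
case/and4P=> dw /eqP uE vuw idle w_min.
set tau' := fun x => _.
have tau'w : tau' w = d.+1 by rewrite /tau' eqxx.
have tau'N x : x != w -> tau' x = tau x by rewrite /tau' => /negPf ->.
have tau'_le x : tau' x <= tau x.
  by rewrite /tau'; case: eqP => // ->; exact: ltnW.
have up j x y : connect (upper tau' j) x y -> connect (upper tau j) x y.
  apply: connect_sub => p q /and3P[pq jp jq]; apply: connect1.
  by rewrite /upper /= pq !(leq_trans _ (tau'_le _)).
have w0 : 0 < tau w by apply: leq_ltn_trans dw.
have white x : (x \notin blue (schedule d)) = (d < tau x) := white_schedule d x.
have [bd ci cf] := schedule_on d.
have [_ cie cfe] := schedule_on (tau w).-1.
have we : w \notin blue (schedule (tau w).-1) by rewrite white_schedule prednK.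
have [uwe kuw] := forcerP cfe we; rewrite -uE in uwe kuw.
have [wd uwd nb] := validP _ _ _ vuw.
have ud : u \in blue (schedule d) by rewrite (subsetP (active_sub ci wd)).
(* Such a [z] in the chain of [w] would have forcer [u], which is idle. *)
have idleP z : tau z = d.+1 -> connect (upper tau d.+1) w z -> kap z != kap w.
  move=> tz wz; apply/eqP => kzw.
  have zd : z \notin blue (schedule d) by rewrite white tz.
  have /forallP/(_ z) := idle; rewrite tz eqxx wz implybF => /eqP[].
  apply: forcer_eq => //; last by rewrite kzw.
  by rewrite (active_comp ci wd) // schedule_comp.
have csym j := upper_connect_sym tau j.
split.
- move=> x y; have [->|xw] := eqVneq x w.
    rewrite tau'w; have [->//|yw] := eqVneq y w; rewrite tau'N // => ty [//|/up wy] k.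
    by have := idleP y (esym ty) wy; rewrite k eqxx.
  have [->|yw] := eqVneq y w.
    rewrite tau'w => tx; rewrite tx => -[//|/up]; rewrite csym => wx k.
    by have := idleP x _ wx; rewrite -tau'N // k eqxx => /(_ tx).
  rewrite !tau'N // => txy [tx|/up cxy]; apply: (layer_inj lay) => //; by [left|right].
- move=> x y z xy.
  (* If [z] is the lowered vertex, [x] is blue at time [d] with a white neighbour in the component,
     so it is the active vertex [u] of the chain, and validity of the force on [w] gives [y = w]. *)
  have [->|zw] := eqVneq z w.
    rewrite tau'w ltnS => xd dy kwx /up wy.
    have [->//|yw] := eqVneq y w; rewrite tau'N // in dy.
    have xw : x != w by apply: contraTneq xd => ->; rewrite tau'w ltnn.
    rewrite tau'N // in xd.
    have yd : y \notin blue (schedule d) by rewrite white.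
    have wy' : y \in white_comp (blue (schedule d)) w by rewrite schedule_comp.
    have xy' : x \in active (schedule d) y.
      by apply: (active_nbr ci) => //; rewrite bd inE.
    rewrite (active_comp ci wd wy') in xy'.
    have ux : u = x by apply: (active_inj ci wd) => //; rewrite kuw.
    by rewrite -ux in xy; rewrite (nb y).
  rewrite (tau'N z) // => xz zy kzx /up zyc.
  have zy' : tau z <= tau y := leq_trans zy (tau'_le y).
  (* If [x] is the lowered vertex, the new case is a [z] of its chain with [tau z < tau w]. Since
     [u] stays active until it forces [w], it would also force [z], prematurely at [d], against the
     choice of [w]. *)
  have [xw|xw] := eqVneq x w; last first.
    by rewrite tau'N // in xz; exact: (layer_replace lay xy).
  rewrite {x}xw tau'w in xy xz kzx *.
  have [zw'|wz] := leqP (tau z) (tau w); last exact: (layer_replace lay xy).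
  have zwc : connect (upper tau (tau z)) z w.
    apply: connect_trans zyc _; apply: connect1.
    by rewrite /upper /= adj_sym xy zy' zw'.
  have [tzw|tzw] := eqVneq (tau z) (tau w).
    by case/eqP: zw; apply: (layer_inj lay) => //; right.
  have lt_zw : tau z < tau w by rewrite ltn_neqAle tzw.
  suff /w_min : premature d u z by rewrite leqNgt lt_zw.
  have z0 : 0 < tau z by apply: leq_ltn_trans xz.
  have wzd : connect (upper tau d.+1) w z.
    by rewrite csym; apply: connect_upper_anti zwc; exact: ltnW.
  have [bz ciz cfz] := schedule_on (tau z).-1.
  have zz : z \notin blue (schedule (tau z).-1) by rewrite white_schedule prednK.
  have uzz : u \in active (schedule (tau z).-1) z.
    rewrite -(active_comp ciz zz (y := w)); last by rewrite schedule_comp prednK.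
    apply: (@schedule_active _ ((tau w).-1 - (tau z).-1)).
      rewrite bz inE; rewrite bd inE in ud; apply: leq_trans ud _.
      by rewrite -ltnS prednK // ltnW.
    by rewrite subnKC // -ltnS !prednK.
  apply/and4P; split=> //.
  + by apply/eqP; rewrite (forcer_eq ciz zz uzz) // kuw kzx.
  + have zd : z \notin blue (schedule d) by rewrite white ltnW.
    have wz' : z \in white_comp (blue (schedule d)) w by rewrite schedule_comp.
    apply/validP; split=> //; first by rewrite (active_comp ci wd wz').
    move=> v uv vz vd; have vw := nb v uv (white_comp_trans wz' vz) vd.
    rewrite vw in uv *; apply/esym/(layer_replace lay uv) => //.
      by rewrite bd inE in ud; apply: leq_ltn_trans ud (ltnW xz).
    by rewrite kuw.
  + apply/forallP=> v; have /forallP/(_ v) := idle.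
    case: (tau v == _) => //=; case: (_ == u) => //=; apply: contraNN.
    exact: connect_trans wzd.
- move=> i; have [x x0 kx] := layer_base lay i; exists x => //.
  by rewrite tau'N //; apply: contraTneq w0 => <-; rewrite x0.
Qed.

End Schedule.

(** Induction on the sum of [tau]: lowering a premature target decreases it. The vertices of time 0
    are in bijection with the chains, so there are [a] of them. *)
Lemma layering_forces tau b : layering tau kap -> (forall x, tau x <= b) ->
  exists B F, [/\ @set_of_forces G B F, all_blue_after F b (init B) & #|B| = a].
Proof.
have [n] := ubnP (\sum_x tau x); elim: n tau => // n IHn tau lt_n lay tau_le.
have [[d [u [w0 pw0]]]|nprem] := pselect (exists d u w, premature tau d u w).
  case: (arg_minnP tau pw0) => w pw w_min.
  apply: (IHn _ _ (lower_premature lay pw w_min)).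
    rewrite -ltnS; apply: leq_trans lt_n; rewrite ltnS.
    rewrite (bigD1 w) //= eqxx [X in _ < X](bigD1 w) //= -addSn leq_add //.
      by case/and4P: pw.
    by apply: leq_sum => x /negPf->.
  move=> x; case: eqP => // _; case/and4P: pw => dw _ _ _.
  exact: leq_trans (ltnW dw) (tau_le w).
have [|F BF Fb] := schedule_all_blue lay tau_le.
  move=> d u w; apply/negP => pw; case: nprem; by exists d, u, w.
exists [set x | tau x == 0], F; split=> //.
have kap_inj : {in [set x | tau x == 0] &, injective kap}.
  move=> x y; rewrite !inE => /eqP x0 /eqP y0.
  by apply: (layer_inj lay); [rewrite y0|left].
rewrite -(card_in_imset kap_inj) -[RHS]card_ord -cardsT; congr #|pred_of_set _|.
apply/setP=> i; rewrite inE; apply/imsetP.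
by have [x x0 kx] := layer_base lay i; exists x; rewrite // inE x0.
Qed.

End LayeringForces.

Theorem theorem3p2 (G : sgraph) (G_nonempty : 0 < #|G|)
    (t : nat) (t_gt0 : 0 < t) :
  le_enat (th G) t <->
  exists a k b : nat,
    [/\ 0 < a, 0 < k, a + b = t &
        obtainable (box (complete_graph a) (kary_tree k b)) G].
Proof.
rewrite le_th; split=> [[B [F [s [BF Fs le_t]]]]|[a [k [b [_ _ <- ]]]]].
  have B_gt0 : 0 < #|B|.
    rewrite lt0n cards_eq0; apply: contraTneq G_nonempty => B0.
    by rewrite B0 in Fs; rewrite -cardsT (all_blue_set0 Fs) cards0.
  have [tau [kap [lay tau_le]]] := forces_layering BF Fs B_gt0.
  (* The height absorbs the slack in [#|B| + s <= t], since a layering only has to fit below the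
     height. *)
  exists #|B|, #|G|, (t - #|B|).
  split=> //; first by rewrite subnKC // (leq_trans _ le_t) ?leq_addr.
  apply/obtainable_model; apply: (layering_model lay) => x.
  by rewrite (leq_trans (tau_le x)) // leq_subRL // (leq_trans _ le_t) ?leq_addr.
move=> /obtainable_model[f /model_layering[tau [kap [lay tau_le]]]].
have [B [F [BF Fb cardB]]] := layering_forces lay tau_le.
by exists B, F, b; rewrite cardB.
Qed.
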